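(* Let $q=e^{-1}$. Then $$\prod_{j\geq1} \frac1{1+q^j} \left(\sum_{k\geq1} \frac{q^k}{1+q^k} \sum_{\ell>k} \frac{q^{\ell-1}}{1+q^{2\ell-1}}\right)= \sum_{\lambda\in \mathcal{P}} (-1)^{\lambda_1}\left( \sum_{\ell\geq1} q^{\vert\lambda\vert-\ell} (\lambda_{2\ell-1}-\lambda_{2\ell})(\lambda_1-\lambda_{\ell}) \right).$$
   Context: $\mathcal P$ is the set of all integer partitions (including the empty partition). A partition $\lambda$ is written $\lambda=(\lambda_1,\lambda_2,\dots,\lambda_\ell)$ with $\lambda_1\ge\lambda_2\ge\cdots\ge\lambda_\ell\ge1$, with the convention $\lambda_j=0$ for $j>\ell$ (so $\lambda_1=0$ for the empty partition); $|\lambda|=\lambda_1+\lambda_2+\cdots$. *)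

(* Defs.v *)
From HB Require Import structures.
From mathcomp Require Import all_boot all_order all_algebra.
From mathcomp Require Import all_classical all_reals all_analysis.
From mathcomp Require Import summability.

Set Implicit Arguments.
Unset Strict Implicit.
Unset Printing Implicit Defensive.

Import Order.TTheory GRing.Theory Num.Theory.
Import numFieldNormedType.Exports.

Local Open Scope classical_set_scope.
Local Open Scope ring_scope.

Record intpart := IntPart {
  parts :> seq nat;
  _ : sorted geq parts && (0%N \notin parts)
}.

HB.instance Definition _ := [isSub for parts].
HB.instance Definition _ := [Countable of intpart by <:].

(* Parts are numbered from 1: [part p j] is lambda_j, and it is 0 when j exceeds
   the number of parts.  The index j = 0 is never used. *)
Definition part (p : intpart) (j : nat) : nat := nth 0%N p j.-1.

Definition weight (p : intpart) : nat := sumn p.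

(* The exponent |lambda| - l is an integer: it can be negative for large l,
   where the other factors vanish. *)
Definition rhs_inner (R : realType) (q : R) (p : intpart) (l : nat) : R :=
  q ^ ((weight p)%:Z - l%:Z)
  * ((part p (2 * l - 1))%:R - (part p (2 * l))%:R)
  * ((part p 1)%:R - (part p l)%:R).

Definition rhs_term (R : realType) (q : R) (p : intpart) : R :=
  (-1) ^+ part p 1 * \big[+%R/0]_(1 <= l <oo) rhs_inner q p l.

Definition lhs_inner (R : realType) (q : R) (l : nat) : R :=
  q ^+ (l - 1) / (1 + q ^+ (2 * l - 1)).

Definition lhs_outer (R : realType) (q : R) (k : nat) : R :=
  q ^+ k / (1 + q ^+ k) * \big[+%R/0]_(k.+1 <= l <oo) lhs_inner q l.

(* Main.v *)
(* Conjugating, a partition is a choice of multiplicities m_1, m_2, ... of the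
   parts 1, 2, ..., with lambda_(2l-1) - lambda_(2l) = m_(2l-1) and
   lambda_1 - lambda_l = m_1 + ... + m_(l-1).  Hence the l-th summand is
   q^(-l) m_(2l-1) (m_1 + ... + m_(l-1)) prod_i (- q^i)^(m_i), and, as k < l <= 2l-1,
   the sum over all multiplicities factorises: a factor i contributes
   1 / (1 + q^i), multiplied by - q^i / (1 + q^i) when i = k or i = 2l-1.
   The same computation with q^i in place of - q^i bounds the sums of absolute
   values, so the unordered sum over partitions can be computed along the boxes
   {at most 2K parts, all multiplicities < M}, first for M, then for K -> oo. *)
Require Import Defs.
From HB Require Import structures.
From mathcomp Require Import all_boot all_order all_algebra.
From mathcomp Require Import all_classical all_reals all_analysis.
From mathcomp Require Import finmap ring lra zify.
From mathcomp Require Import summability.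

Set Implicit Arguments.
Unset Strict Implicit.
Unset Printing Implicit Defensive.

Import Order.TTheory GRing.Theory Num.Theory.
Import numFieldNormedType.Exports.

Local Open Scope classical_set_scope.
Local Open Scope ring_scope.

(** * Unordered sums as limits over finite sets *)

Section NetSums.
Local Open Scope fset_scope.

Lemma sum_fsetD (V : zmodType) (I : choiceType) (f : I -> V) (A B : {fset I}) :
  A `<=` B ->
  \sum_(i <- B `\` A) f i = \sum_(i <- B) f i - \sum_(i <- A) f i.
Proof.
move=> sAB; rewrite (big_fsetID _ (mem A) B) /=.
have -> : [fset x | x in B & x \in A] = A.
  apply/fsetP => x; rewrite !inE /= andbC.
  by case: (boolP (x \in A)) => // /(fsubsetP sAB) ->.
have -> : [fset x | x in B & x \notin A] = B `\` A.
  by apply/fsetP => x; rewrite !inE /= andbC.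
by rewrite [RHS]addrC addKr.
Qed.

Lemma ler_sum_fsubset (R : numDomainType) (I : choiceType) (f : I -> R)
    (A B : {fset I}) :
  (forall i, 0 <= f i) -> A `<=` B ->
  \sum_(i <- A) f i <= \sum_(i <- B) f i.
Proof.
by move=> f0 sAB; rewrite -subr_ge0 -sum_fsetD// sumr_ge0.
Qed.

(** If [A0] comes within e/2 of the supremum of the absolute sums, then any finite set disjoint from
    some [A] containing [A0] has absolute sum below e/2. Good approximations [B] that are merely
    cofinal therefore force the whole net to converge, so a sum can be computed along boxes. *)
Lemma cvg_partial_sum (R : realType) (I : choiceType) (f : I -> R) (L C : R) :
  (forall A : {fset I}, \sum_(i <- A) `|f i| <= C) ->
  (forall (A : {fset I}) e, 0 < e ->
     exists2 B : {fset I}, A `<=` B & `|L - \sum_(i <- B) f i| < e) ->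
  partial_sum f A @[A --> totally] --> L.
Proof.
move=> fC fL; pose E := [set \sum_(i <- A) `|f i| | A in @setT {fset I}]%classic.
have supE : has_sup E.
  split; first by exists (\sum_(i <- fset0) `|f i|), fset0.
  by exists C => _ [A _ <-].
have ? := @totally_filter I; apply/cvgrPdist_lt => e e0.
have e20 : 0 < e / 2 by rewrite divr_gt0.
have [_ [A0 _ <-] A0e] := sup_adherent e20 supE.
exists A0 => // A /= sA0A.
have [B sAB LB] := fL A _ e20.
rewrite /partial_sum -(big_seq_fsetE _ A xpredT).
rewrite -(subrK (\sum_(i <- B) f i) L) -addrA (splitr e).
apply: le_lt_trans (ler_normD _ _) _; rewrite ltrD//.
rewrite -sum_fsetD//; apply: le_lt_trans (ler_norm_sum _ _ _) _.
rewrite sum_fsetD//.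
have : \sum_(i <- B) `|f i| <= sup E by apply: sup_upper_bound => //; exists B.
have : \sum_(i <- A0) `|f i| <= \sum_(i <- A) `|f i| by apply: ler_sum_fsubset.
by move: A0e; lra.
Qed.

End NetSums.

(** * Geometric series, their weighted variants, and triangular sums *)

Section Series.
Variable R : realType.
Implicit Types (x : R) (u v : nat -> R).

Lemma cvg_sum_expr x : `|x| < 1 ->
  \sum_(0 <= j < n) x ^+ j @[n --> \oo] --> (1 - x)^-1.
Proof.
move=> x1; have := @cvg_geometric_series R 1 x x1; rewrite mul1r.
apply: cvg_trans; apply: near_eq_cvg; near=> n; rewrite /series /=.
by apply: eq_bigr => i _; rewrite mul1r.
Unshelve. all: by end_near. Qed.

Lemma sum_expr_le x m n : 0 <= x < 1 -> \sum_(m <= j < n) x ^+ j <= (1 - x)^-1.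
Proof.
move=> /andP[x0 x1]; apply: (@le_trans _ _ (\sum_(0 <= j < n) x ^+ j)).
  have [mn|nm] := leqP m n; last first.
    by rewrite big_geq ?(ltnW nm)// sumr_ge0// => j _; rewrite exprn_ge0.
  by rewrite [leRHS](@big_cat_nat _ _ _ m) //= lerDr sumr_ge0// => j _; rewrite exprn_ge0.
have cx : cvgn (fun k => \sum_(0 <= j < k) x ^+ j).
  by apply/cvg_ex; eexists; apply: cvg_sum_expr; rewrite ger0_norm.
rewrite -(cvg_lim (@Rhausdorff R) (@cvg_sum_expr x _)) ?ger0_norm//.
apply: (nondecreasing_cvgn_le (u_ := fun k => \sum_(0 <= j < k) x ^+ j)) => // a b ab.
rewrite [leRHS](@big_cat_nat _ _ _ a) //= lerDl sumr_ge0// => j _.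
by rewrite exprn_ge0.
Qed.

(** With [|x| = y ^+ 2], each of 1, y, ..., y^(n-1) is at least y^n, so n y^n <= 1/(1-y) and n |x|^n
    <= y^n/(1-y). *)
Lemma cvg_natmul_expr x : `|x| < 1 -> n%:R * x ^+ n @[n --> \oo] --> 0.
Proof.
move=> x1; set y := Num.sqrt `|x|.
have y0 : 0 <= y by rewrite sqrtr_ge0.
have y1 : y < 1 by rewrite -sqrtr1 ltr_sqrt.
have yn n : n%:R * y ^+ n <= (1 - y)^-1.
  apply: le_trans (sum_expr_le 0 n _); last by rewrite y0.
  rewrite -[n in n%:R]subn0 mulr_natl -sumr_const_nat; apply: ler_sum_nat => i /andP[_ ni].
  by apply: ler_wiXn2l => //; [exact: ltW|exact: ltnW].
apply: norm_cvg0.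
have cy : (1 - y)^-1 * y ^+ n @[n --> \oo] --> 0.
  rewrite -(mulr0 (1 - y)^-1); apply: cvgMr.
  by apply: cvg_expr; rewrite ger0_norm.
apply: (squeeze_cvgr _ (cvg_cst 0) cy); near=> n.
rewrite normr_ge0/= normrM normrX ger0_norm ?ler0n// -(sqr_sqrtr (normr_ge0 x)).
rewrite -/y exprAC expr2 mulrA ler_wpM2r//.
by rewrite exprn_ge0.
Unshelve. all: by end_near. Qed.

(** Multiplying the partial sum by 1 - x leaves a geometric sum. The limit keeps 1/(1-x) apart
    because every part size contributes that factor; weighting by the multiplicity multiplies it by
    x/(1-x). *)
Lemma cvg_sum_natmul_expr x : `|x| < 1 ->
  \sum_(0 <= j < n) j%:R * x ^+ j @[n --> \oo] --> (1 - x)^-1 * (x / (1 - x)).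
Proof.
move=> x1; have nx1 : 1 - x != 0.
  by rewrite subr_eq0; apply: contraTneq x1 => <-; rewrite normr1 ltxx.
have E n : \sum_(0 <= j < n) j%:R * x ^+ j =
    (1 - x)^-1 * (\sum_(0 <= j < n) x ^+ j - 1 + x ^+ n - n%:R * x ^+ n).
  apply: (mulfI nx1); rewrite mulrA divff// mul1r.
  elim: n => [|n IHn]; first by rewrite !big_geq// expr0; ring.
  by rewrite !big_nat_recr//= mulrDr IHn exprS -natr1; ring.
under eq_fun do rewrite E.
apply: cvgMr.
have -> : x / (1 - x) = (1 - x)^-1 - 1 + 0 - 0 by field.
apply: cvgB; last exact: cvg_natmul_expr.
apply: cvgD; last exact: cvg_expr.
by apply: cvgB; [exact: cvg_sum_expr|exact: cvg_cst].
Qed.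

Lemma cvg_sum_eventually0 u m N : (m <= N)%N -> (forall l, (N <= l)%N -> u l = 0) ->
  \sum_(m <= l < n) u l @[n --> \oo] --> \sum_(m <= l < N) u l.
Proof.
move=> mN u0; apply: cvg_near_cst; near=> n.
have Nn : (N <= n)%N by near: n; exact: nbhs_infty_ge.
rewrite (@big_cat_nat _ _ _ N) //= [X in _ + X]big1_seq ?addr0// => l.
by rewrite mem_index_iota => /andP[_ /andP[/u0]].
Unshelve. all: by end_near. Qed.

Lemma is_cvg_sum_geom_dominated u m (C x : R) : 0 <= x < 1 ->
  (forall l, (m <= l)%N -> 0 <= u l <= C * x ^+ l) ->
  cvgn (fun n => \sum_(m <= l < n) u l).
Proof.
move=> x01 uC; apply: nondecreasing_is_cvgn.
  move=> a b ab; have [ma|am] := leqP m a.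
    rewrite [leRHS](@big_cat_nat _ _ _ a) //= lerDl big_seq sumr_ge0// => j.
    by rewrite mem_index_iota => /andP[aj _]; case/andP: (uC j (leq_trans ma aj)).
  rewrite big_geq ?(ltnW am)// big_seq sumr_ge0// => j.
  by rewrite mem_index_iota => /andP[aj _]; case/andP: (uC j aj).
exists (`|C| * (1 - x)^-1) => _ [n _ <-].
apply: (@le_trans _ _ (\sum_(m <= l < n) `|C| * x ^+ l)).
  apply: ler_sum_nat => l /andP[ml _]; case/andP: (uC l ml) => _ /le_trans; apply.
  by rewrite ler_wpM2r ?ler_norm// exprn_ge0//; case/andP: x01.
by rewrite -mulr_sumr ler_wpM2l// sum_expr_le.
Qed.

(* The triangular sum differs from the sum of [u k * (tail of v)] by
   [(sum of u) * (tail of v)], which tends to 0. *)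
Lemma cvg_sum_triangle u v :
  cvgn (fun n => \sum_(1 <= k < n) u k) ->
  cvgn (fun n => \sum_(1 <= k < n) v k) ->
  cvgn (fun n => \sum_(1 <= k < n) u k * limn (fun n => \sum_(k.+1 <= l < n) v l)) ->
  \sum_(1 <= l < n.+1) \sum_(1 <= k < l) u k * v l @[n --> \oo] -->
  limn (fun n => \sum_(1 <= k < n) u k * limn (fun n => \sum_(k.+1 <= l < n) v l)).
Proof.
move=> cu cv cuv; set V := limn (fun n => \sum_(1 <= k < n) v k).
have tailE k : (1 <= k)%N ->
    limn (fun n => \sum_(k.+1 <= l < n) v l) = V - \sum_(1 <= l < k.+1) v l.
  move=> k1; apply: cvg_lim; first exact: Rhausdorff.
  have : \sum_(1 <= l < n) v l - \sum_(1 <= l < k.+1) v l @[n --> \oo] -->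
      V - \sum_(1 <= l < k.+1) v l by apply: cvgB => //; exact: cvg_cst.
  apply: cvg_trans; apply: near_eq_cvg; near=> n.
  have kn : (k.+1 <= n)%N by near: n; exact: nbhs_infty_ge.
  by rewrite [X in X - _](@big_cat_nat _ _ _ k.+1) //= [LHS]addrC addKr.
have triE n : \sum_(1 <= l < n.+1) \sum_(1 <= k < l) u k * v l =
    \sum_(1 <= k < n.+1) u k * limn (fun n => \sum_(k.+1 <= l < n) v l) -
    (\sum_(1 <= k < n.+1) u k) * (V - \sum_(1 <= l < n.+1) v l).
  elim: n => [|n IHn]; first by rewrite !big_geq// mul0r subr0.
  rewrite !(@big_nat_recr _ _ _ n.+1)//= IHn tailE// -mulr_suml (@big_nat_recr _ _ _ n.+1)//=.
  by ring.
under eq_fun do rewrite triE.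
(* The vanishing correction is written as a product with [V - V] so that the limit matches [triE]
   term by term. *)
set W := limn _; have -> : W = W - limn (fun n => \sum_(1 <= k < n) u k) * (V - V).
  by rewrite subrr mulr0 subr0.
have shiftS (w : nat -> R) : cvgn (fun n => \sum_(1 <= k < n) w k) ->
    \sum_(1 <= k < n.+1) w k @[n --> \oo] --> limn (fun n => \sum_(1 <= k < n) w k).
  by rewrite -(cvg_shiftS (fun n => \sum_(1 <= k < n) w k)).
apply: cvgB; first exact: shiftS.
apply: cvgM; first exact: shiftS.
by apply: cvgB; [exact: cvg_cst|exact: shiftS].
Unshelve. all: by end_near. Qed.

End Series.

(** * Partitions from the multiplicities of their conjugates *)

(** Zeros come last in a nonincreasing sequence, so removing them only shortens it, and the default
    0 of [nth] fills the gap. *)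
Lemma nth_filter_sorted_geq (s : seq nat) j : sorted geq s ->
  nth 0%N [seq x <- s | x != 0%N] j = nth 0%N s j.
Proof.
elim: s j => [//|x s IHs] j sxs /=; have ss := path_sorted sxs.
have [x0|xn0] := eqVneq x 0%N; last by case: j => [//|j] /=; exact: IHs.
have s0 : all (pred1 0%N) s.
  apply/allP => y ys; move/(order_path_min (rev_trans leq_trans))/allP: sxs => /(_ y ys).
  by rewrite x0 /= leqn0.
have -> : [seq x0 <- s | x0 != 0%N] = [::].
  by apply/eqP; rewrite -[_ == _]negbK -has_filter -all_predC; apply: sub_all s0 => y /= ->.
rewrite nth_nil x0; case: j => [//|j] /=; rewrite (all_pred1P _ _ s0) nth_nseq.
by case: ifP.
Qed.

(** Part number [j.+1] counts the conjugate parts larger than [j], hence is a tail sum of [m];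
    vanishing tail sums are dropped because a partition has no zero parts. *)
Definition mult_parts (N : nat) (m : nat -> nat) : seq nat :=
  [seq x <- mkseq (fun j => \sum_(j <= i < N) m i)%N N | x != 0%N].

Lemma sum_tail_anti (N : nat) (m : nat -> nat) j k : (j <= k)%N ->
  (\sum_(k <= i < N) m i <= \sum_(j <= i < N) m i)%N.
Proof.
move=> jk; have [kN|Nk] := leqP k N; last by rewrite big_geq ?(ltnW Nk).
by rewrite [leqRHS](@big_cat_nat _ _ _ k)//= leq_addl.
Qed.

Lemma sorted_mkseq_tail (N : nat) (m : nat -> nat) :
  sorted geq (mkseq (fun j => \sum_(j <= i < N) m i)%N N).
Proof.
apply: (@homo_sorted _ _ _ leq); last exact: iota_sorted.
by move=> j k jk; exact: sum_tail_anti.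
Qed.

Lemma mult_parts_subproof (N : nat) (m : nat -> nat) :
  sorted geq (mult_parts N m) && (0%N \notin mult_parts N m).
Proof.
rewrite mem_filter eqxx andbT.
apply: sorted_filter; last exact: sorted_mkseq_tail.
exact: (rev_trans leq_trans).
Qed.

(* The partition whose conjugate has [m i] parts equal to [i.+1], for [i < N]. *)
Definition part_of_mult (N : nat) (m : nat -> nat) : intpart :=
  IntPart (mult_parts_subproof N m).

Lemma part_of_multE (N : nat) (m : nat -> nat) j :
  part (part_of_mult N m) j.+1 = (\sum_(j <= i < N) m i)%N.
Proof.
rewrite /part /= nth_filter_sorted_geq; last exact: sorted_mkseq_tail.
have [jN|Nj] := ltnP j N; first by rewrite nth_mkseq.
by rewrite nth_default ?size_mkseq// big_geq.
Qed.

Lemma weight_part_of_mult (N : nat) (m : nat -> nat) :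
  weight (part_of_mult N m) = (\sum_(0 <= i < N) i.+1 * m i)%N.
Proof.
have -> : weight (part_of_mult N m) = (\sum_(0 <= j < N) \sum_(j <= i < N) m i)%N.
  rewrite /weight /= sumnE big_filter big_mkcond /= big_map /index_iota subn0.
  by apply: eq_bigr => j _; case: eqP => [->|].
elim: N => [|N IHN]; first by rewrite !big_geq.
rewrite [RHS]big_nat_recr//= -IHN.
(* The new multiplicity [m N] enters each of the [N.+1] tail sums exactly once. *)
have -> : (N.+1 * m N = \sum_(0 <= j < N.+1) m N)%N by rewrite sum_nat_const_nat subn0.
rewrite [in RHS]big_nat_recr//= addnA -big_split/= big_nat_recr//= big_nat1.
by congr (_ + _)%N; apply: eq_big_nat => j /andP[_ jN]; rewrite big_nat_recr// ltnW.
Qed.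

(** The tail sums of the differences of consecutive parts telescope back to the parts. *)
Lemma intpart_part_of_mult (p : intpart) N : (size p <= N)%N ->
  p = part_of_mult N (fun i => part p i.+1 - part p i.+2)%N.
Proof.
move=> pN; apply: val_inj; rewrite /= /mult_parts.
have /andP[sp p0] := valP p.
have nthp : {homo nth 0%N p : j k / (j <= k)%N >-> (k <= j)%N}.
  move=> j k jk; have [kp|pk] := ltnP k (size p); last by rewrite (nth_default _ pk).
  apply: (sorted_leq_nth (rev_trans leq_trans) leqnn 0%N sp) => //.
  by rewrite inE (leq_ltn_trans jk).
have -> : mkseq (fun j => \sum_(j <= i < N) (part p i.+1 - part p i.+2))%N N =
    val p ++ nseq (N - size p) 0%N.
  apply: (@eq_from_nth _ 0%N); first by rewrite size_mkseq size_cat size_nseq subnKC.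
  move=> j; rewrite size_mkseq => jN; rewrite nth_mkseq// nth_cat nth_nseq if_same.
  have -> : (if (j < size (val p))%N then nth 0%N (val p) j else 0%N) = nth 0%N p j.
    by case: ltnP => // pj; rewrite nth_default.
  (* The boundary term [nth 0 p N] makes the induction on [N] possible and vanishes since [p] has at
     most [N] parts. Truncated subtraction is exact because the parts do not increase. *)
  have : (\sum_(j <= i < N) (part p i.+1 - part p i.+2) + nth 0 p N = nth 0 p j)%N.
    rewrite /part/=; elim: N jN {pN} => [//|N IHN]; rewrite ltnS leq_eqVlt.
    case/predU1P => [->|jN]; first by rewrite big_nat1 subnK// nthp.
    by rewrite big_nat_recr ?(ltnW jN)//= -addnA subnK ?IHN// nthp.
  by rewrite (nth_default _ pN) addn0.
rewrite filter_cat -[LHS]cats0; congr (_ ++ _); last by elim: (N - size p)%N.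
by symmetry; apply/all_filterP/allP => x xp; apply: contraNneq p0; move: xp => /[swap] ->.
Qed.

(** * Finite boxes of partitions *)

Section Box.
Variables (N M : nat).

Definition ffun_mult (f : {ffun 'I_N -> 'I_M}) (i : nat) : nat :=
  oapp (fun i' => nat_of_ord (f i')) 0%N (insub i).

Lemma ffun_multE f (i : 'I_N) : ffun_mult f i = f i.
Proof. by rewrite /ffun_mult valK. Qed.

(** Indexing by finite functions turns a sum over the box into a sum over all multiplicity vectors,
    ready for distributivity. *)
Definition box : {fset intpart} :=
  [fset part_of_mult N (ffun_mult f) | f in {ffun 'I_N -> 'I_M}]%fset.

Lemma part_of_ffun_mult_inj :
  injective (fun f : {ffun 'I_N -> 'I_M} => part_of_mult N (ffun_mult f)).
Proof.
move=> f g fg; apply/ffunP => i; apply: val_inj; rewrite /= -!ffun_multE.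
have tail j : (\sum_(j <= i < N) ffun_mult f i = \sum_(j <= i < N) ffun_mult g i)%N.
  by rewrite -!part_of_multE fg.
(* Consecutive tail sums differ by the single multiplicity at [i]. *)
have := tail i; rewrite !(@big_ltn _ _ _ i)// tail.
by move/addIn.
Qed.

Lemma big_box (V : nmodType) (F : intpart -> V) :
  \sum_(p <- box) F p = \sum_f F (part_of_mult N (ffun_mult f)).
Proof.
rewrite big_imfset; last by move=> f g _ _; exact: part_of_ffun_mult_inj.
by rewrite /= big_enum.
Qed.

Lemma mem_box (p : intpart) : (size p <= N)%N -> (part p 1 < M)%N -> p \in box.
Proof.
move=> pN pM; apply/imfsetP => /=.
pose m i := (part p i.+1 - part p i.+2)%N.
(* A multiplicity is a difference of parts, hence at most the largest part. *)
have mM i : (m i < M)%N.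
  apply: leq_ltn_trans pM; apply: leq_trans (leq_subr _ _) _.
  rewrite (intpart_part_of_mult (leqnn (size p))) !part_of_multE.
  exact: sum_tail_anti.
exists [ffun i : 'I_N => Ordinal (mM i)] => //.
rewrite [LHS](intpart_part_of_mult pN); apply: val_inj; rewrite /= /mult_parts.
congr [seq x <- _ | x != 0%N]; apply: eq_mkseq => j; apply: eq_big_nat => i /andP[_ iN].
by rewrite (ffun_multE _ (Ordinal iN)) ffunE.
Qed.

End Box.

Lemma box_exhaust (A : {fset intpart}) : exists n0, forall N M,
  (n0 <= N)%N -> (n0 <= M)%N -> (A `<=` box N M)%fset.
Proof.
(* This number exceeds both the number of parts and the largest part of every member of [A]. *)
exists (\sum_(p <- A) (size p + part p 1).+1)%N => N M nN nM.
apply/fsubsetP => p pA.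
have : ((size p + part p 1).+1 <= \sum_(p <- A) (size p + part p 1).+1)%N.
  by rewrite (big_fsetD1 p)//= leq_addr.
by move=> h; apply: mem_box; lia.
Qed.

(** * The summand in terms of multiplicities *)

Section Terms.
Variable R : realType.
Implicit Types (q s : R) (p : intpart).

Lemma part_anti p j k : (0 < j)%N -> (j <= k)%N -> (part p k <= part p j)%N.
Proof.
case: j => // j _; case: k => // k jk.
rewrite (intpart_part_of_mult (leqnn (size p))) !part_of_multE.
exact: sum_tail_anti.
Qed.

Lemma rhs_inner_ge0 q p l : 0 <= q -> (0 < l)%N -> 0 <= rhs_inner q p l.
Proof.
move=> q0 l0; rewrite /rhs_inner !mulr_ge0 ?exprz_ge0// subr_ge0 ler_nat.
  by apply: part_anti; lia.
exact: part_anti.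
Qed.

Lemma rhs_inner_eq0 q p l : (size p < l)%N -> rhs_inner q p l = 0.
Proof.
move=> pl; have part0 j : (l <= j)%N -> part p j = 0%N.
  by move=> lj; rewrite /part nth_default//; lia.
by rewrite /rhs_inner (part0 (2 * l - 1)%N) ?(part0 (2 * l)%N) ?subrr ?mulr0 ?mul0r//; lia.
Qed.

Lemma cvg_rhs_inner q p :
  \sum_(1 <= l < n) rhs_inner q p l @[n --> \oo] -->
  \sum_(1 <= l < (size p).+1) rhs_inner q p l.
Proof. by apply: cvg_sum_eventually0 => // l; exact: rhs_inner_eq0. Qed.

Lemma part_of_multE_gt0 N (m : nat -> nat) j : (0 < j)%N ->
  part (part_of_mult N m) j = (\sum_(j.-1 <= i < N) m i)%N.
Proof. by case: j => // j _; exact: part_of_multE. Qed.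

(* The summand is the case [s = -1] and its absolute value the case [s = 1]. *)
Definition signed_term s q p : R :=
  s ^+ part p 1 * \sum_(1 <= l < (size p).+1) rhs_inner q p l.

Lemma rhs_termE q p : rhs_term q p = signed_term (-1) q p.
Proof.
by rewrite /rhs_term (cvg_lim (@Rhausdorff R) (@cvg_rhs_inner q p)).
Qed.

Lemma norm_rhs_term q p : 0 <= q -> `|rhs_term q p| = signed_term 1 q p.
Proof.
move=> q0; rewrite rhs_termE /signed_term normrM normrX normrN1 !expr1n !mul1r.
rewrite ger0_norm// big_seq sumr_ge0// => l.
by rewrite mem_index_iota => /andP[l0 _]; exact: rhs_inner_ge0.
Qed.

(** As [m] is indexed from 0, [m (2 * l - 2)] and [m k.-1] are the multiplicities of the conjugate
    parts 2l-1 and k; [l <= K] keeps 2l-1 among the 2K available sizes. *)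
Lemma rhs_inner_part_of_mult q K (m : nat -> nat) l : q != 0 -> (0 < l <= K)%N ->
  rhs_inner q (part_of_mult K.*2 m) l =
  \sum_(1 <= k < l) q ^+ weight (part_of_mult K.*2 m) *
    (q ^- l * ((m (2 * l - 2)%N)%:R * (m k.-1)%:R)).
Proof.
move=> q0 /andP[l0 lK]; rewrite /rhs_inner expfzDr// -exprnN -exprnP.
have l1 : (0 < 2 * l - 1)%N by lia.
have l2 : (0 < 2 * l)%N by lia.
rewrite !part_of_multE_gt0//.
have -> : ((2 * l - 1).-1 = 2 * l - 2)%N by lia.
have -> : ((2 * l).-1 = (2 * l - 2).+1)%N by lia.
rewrite (@big_ltn _ _ _ (2 * l - 2)%N); last by lia.
rewrite natrD addrK (@big_cat_nat _ _ _ l.-1 0) //=; last by lia.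
rewrite natrD addrK natr_sum.
rewrite -{2}(prednK l0) big_add1 /= mulr_sumr; apply: eq_bigr => k _.
by rewrite -!mulrA prednK.
Qed.

Lemma signed_term_part_of_mult s q K (m : nat -> nat) : q != 0 ->
  signed_term s q (part_of_mult K.*2 m) =
  \sum_(1 <= l < K.+1) \sum_(1 <= k < l) q ^- l *
    ((m (2 * l - 2)%N)%:R * (m k.-1)%:R * \prod_(i < K.*2) (s * q ^+ i.+1) ^+ m i).
Proof.
move=> q0; set p := part_of_mult _ m.
(* The largest part is the sum of all multiplicities, and the weight is their sum weighted by part
   size. *)
have -> : \prod_(i < K.*2) (s * q ^+ i.+1) ^+ m i = s ^+ part p 1 * q ^+ weight p.
  rewrite -(big_mkord xpredT (fun i => (s * q ^+ i.+1) ^+ m i)).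
  rewrite part_of_multE weight_part_of_mult -!prodrXr -big_split/=.
  by apply: eq_bigr => i _; rewrite exprMn -exprM.
(* Cutting at [size p] or at [K] gives the limit of the same series: its terms vanish for l > K,
   since [p] has at most 2K parts. *)
have -> : signed_term s q p = s ^+ part p 1 * \sum_(1 <= l < K.+1) rhs_inner q p l.
  congr (_ * _); rewrite -(cvg_lim (@Rhausdorff R) (@cvg_rhs_inner q p)).
  apply: cvg_lim; first exact: Rhausdorff.
  apply: cvg_sum_eventually0 => // l Kl; rewrite /rhs_inner.
  have part0 j : (K.*2 < j)%N -> part p j = 0%N.
    by case: j => // j Kj; rewrite part_of_multE big_geq.
  rewrite (part0 (2 * l - 1)%N) ?(part0 (2 * l)%N); [|lia..].
  by rewrite subrr mulr0 mul0r.
rewrite mulr_sumr; apply: eq_big_nat => l lK.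
rewrite rhs_inner_part_of_mult// mulr_sumr; apply: eq_bigr => k _.
by rewrite -/p; ring.
Qed.

(** * Sums over a box as the multiplicity bound grows *)

Lemma prod_if_pair (I : finType) (a b : I) (g : I -> R) : a != b ->
  \prod_i (if (i == a) || (i == b) then g i else 1) = g a * g b.
Proof.
move=> ab; rewrite (bigD1 a)//= eqxx/= (bigD1 b) 1?eq_sym//= eqxx orbT big1 ?mulr1//.
by move=> i /andP[/negPf -> /negPf ->].
Qed.

(** Since [a] and [b] differ, the weights [f a] and [f b] go into two separate factors of the
    product, and distributivity exchanges sum and product. *)
Lemma sum_ffun_pair N M (x : 'I_N -> R) (a b : 'I_N) : a != b ->
  \sum_(f : {ffun 'I_N -> 'I_M}) (f a)%:R * (f b)%:R * \prod_i x i ^+ f i =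
  \prod_i \sum_(0 <= j < M) (if (i == a) || (i == b) then j%:R else 1) * x i ^+ j.
Proof.
move=> ab; under [RHS]eq_bigr do rewrite big_mkord.
rewrite bigA_distr_bigA; apply: eq_bigr => f _; rewrite big_split/=.
by rewrite (prod_if_pair (fun i => (f i)%:R)).
Qed.

Lemma cvg_sum_ffun_pair N (x : 'I_N -> R) (a b : 'I_N) : a != b ->
  (forall i, `|x i| < 1) ->
  \sum_(f : {ffun 'I_N -> 'I_M}) (f a)%:R * (f b)%:R * \prod_i x i ^+ f i
    @[M --> \oo] -->
  \prod_i (1 - x i)^-1 * (x a / (1 - x a) * (x b / (1 - x b))).
Proof.
move=> ab x1; under eq_fun do rewrite sum_ffun_pair//.
rewrite -(prod_if_pair (fun i => x i / (1 - x i)) ab) -big_split/=.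
apply: cvg_big => [|i _]; first exact: mul_continuous.
case: ifP => _; first exact: cvg_sum_natmul_expr.
by rewrite mulr1; under eq_fun do under eq_bigr do rewrite mul1r; exact: cvg_sum_expr.
Qed.

Lemma cvg_sum_nat (u : nat -> nat -> R) (w : nat -> R) a b :
  (forall i, (a <= i < b)%N -> u i n @[n --> \oo] --> w i) ->
  \sum_(a <= i < b) u i n @[n --> \oo] --> \sum_(a <= i < b) w i.
Proof.
move=> uw; rewrite big_seq; under eq_fun do rewrite big_seq.
apply: cvg_big => [|i]; first exact: add_continuous.
by rewrite mem_index_iota => /uw.
Qed.

(** For [s = -1] this is the left-hand side of the theorem cut to 2K factors and to the triangle k <
    l <= K; for [s = 1] it bounds the absolute sums. *)
Definition box_limit s q K : R :=
  \prod_(1 <= j < K.*2.+1) (1 - s * q ^+ j)^-1 *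
  \sum_(1 <= l < K.+1) \sum_(1 <= k < l)
    q ^+ k / (1 - s * q ^+ k) * (q ^+ (l - 1) / (1 - s * q ^+ (2 * l - 1))).

Lemma cvg_sum_box s q K : `|s| = 1 -> 0 < q < 1 ->
  \sum_(p <- box K.*2 M) signed_term s q p @[M --> \oo] --> box_limit s q K.
Proof.
move=> s1 /andP[q0 q1]; have qn0 : q != 0 by rewrite gt_eqF.
(* The two weighted factors each bring one [s] into the numerator, and these cancel. *)
have s2 : s * s = 1 by rewrite -expr2 -[s ^+ 2]real_normK ?num_real// s1 expr1n.
have sq1 j : `|s * q ^+ j.+1| < 1.
  by rewrite normrM s1 mul1r ger0_norm ?exprn_ge0 ?ltW// exprn_ilt1// ltW.
have E M : \sum_(p <- box K.*2 M) signed_term s q p =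
    \sum_(1 <= l < K.+1) \sum_(1 <= k < l) q ^- l *
      \sum_(f : {ffun 'I_K.*2 -> 'I_M})
        ((ffun_mult f (2 * l - 2)%N)%:R * (ffun_mult f k.-1)%:R *
         \prod_(i < K.*2) (s * q ^+ i.+1) ^+ f i).
  rewrite big_box; under eq_bigr do rewrite signed_term_part_of_mult//.
  rewrite exchange_big; apply: eq_bigr => l _; rewrite exchange_big; apply: eq_bigr => k _.
  rewrite -mulr_sumr; congr (_ * _); apply: eq_bigr => f _; congr (_ * _).
  by apply: eq_bigr => i _; rewrite ffun_multE.
under eq_fun do rewrite E.
rewrite /box_limit mulr_sumr; apply: cvg_sum_nat => l /andP[l0 lK].
rewrite mulr_sumr; apply: cvg_sum_nat => k /andP[k0 kl].
have aK : (2 * l - 2 < K.*2)%N by lia.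
have bK : (k.-1 < K.*2)%N by lia.
have ab : Ordinal aK != Ordinal bK by rewrite -val_eqE /=; lia.
have := cvg_sum_ffun_pair (x := fun i : 'I_K.*2 => s * q ^+ i.+1) ab (fun i => sq1 i).
under eq_fun do under eq_bigr do rewrite -!ffun_multE.
rewrite /= prednK// (_ : (2 * l - 2).+1 = 2 * l - 1)%N; last by lia.
have -> : \prod_(i < K.*2) (1 - s * q ^+ i.+1)^-1 =
    \prod_(1 <= j < K.*2.+1) (1 - s * q ^+ j)^-1 by rewrite big_add1 big_mkord.
move=> c.
set P := \prod_(_ <= _ < _) _ in c *.
set b := (1 - s * q ^+ (2 * l - 1))^-1 in c *; set a := (1 - s * q ^+ k)^-1 in c *.
suff -> : P * (q ^+ k * a * (q ^+ (l - 1) * b)) =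
    q ^- l * (P * (s * q ^+ (2 * l - 1) * b * (s * q ^+ k * a))) by exact: cvgMr.
(* Splitting 2l-1 as l + (l-1) lets [q ^- l] reduce q^(2l-1) to the q^(l-1) of [lhs_inner]. *)
have -> : q ^+ (2 * l - 1) = q ^+ l * q ^+ (l - 1) by rewrite -exprD; congr (_ ^+ _); lia.
have ql : q ^- l * q ^+ l = 1 by rewrite mulVf// expf_neq0.
transitivity ((s * s) * (q ^- l * q ^+ l) * (P * (q ^+ k * a * (q ^+ (l - 1) * b)))).
  by rewrite s2 ql !mul1r.
by ring.
Qed.

(** * Bounds uniform in K, for absolute summability *)

(** For y = q^j, 1/(1-y) = 1 + y/(1-y) <= exp(y/(1-q)); the exponents then add up to at most a
    geometric series. *)
Lemma prod_1Bexpr_le q n : 0 < q < 1 ->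
  \prod_(1 <= j < n) (1 - q ^+ j)^-1 <= expR ((1 - q)^-1 * (1 - q)^-1).
Proof.
move=> /andP[q0 q1].
apply: (@le_trans _ _ (expR ((1 - q)^-1 * \sum_(1 <= j < n) q ^+ j))); last first.
  by rewrite ler_expR ler_wpM2l ?invr_ge0 ?subr_ge0 ?sum_expr_le ?(ltW q0)// ltW.
elim: n => [|n IHn]; first by rewrite !big_geq// mulr0 expR0.
case: n IHn => [|n] IHn; first by rewrite !big_geq// mulr0 expR0.
rewrite !(@big_nat_recr _ _ _ n.+1)//= mulrDr expRD.
have qn : q ^+ n.+1 <= q by rewrite -[leRHS]expr1 ler_wiXn2l// ltW.
have qn1 : 0 < 1 - q ^+ n.+1 by rewrite subr_gt0 (le_lt_trans qn).
apply: ler_pM => //.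
- by rewrite big_seq prodr_ge0// => j; rewrite mem_index_iota => /andP[j0 _];
    rewrite invr_ge0 subr_ge0 exprn_ile1// ltW.
- by rewrite invr_ge0 ltW.
- apply: le_trans (expR_ge1Dx _).
  have -> : (1 - q ^+ n.+1)^-1 = 1 + (1 - q ^+ n.+1)^-1 * q ^+ n.+1.
    by field; rewrite gt_eqF.
  rewrite lerD2l ler_wpM2r ?exprn_ge0 ?(ltW q0)//.
  have q10 : 0 < 1 - q by rewrite subr_gt0.
  by rewrite lef_pV2 ?posrE// lerD2l lerN2.
Qed.

(** Each denominator is at least 1 - q, so extending the range of k separates the double sum into
    two geometric series; [q^-1] comes from q^(l-1) = q^(-1) q^l. *)
Lemma box_limit_le q K : 0 < q < 1 ->
  box_limit 1 q K <= expR ((1 - q)^-1 * (1 - q)^-1) *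
    (((1 - q)^-1 * (1 - q)^-1) * ((1 - q)^-1 * (q^-1 * (1 - q)^-1))).
Proof.
move=> q01; have /andP[q0 q1] := q01; rewrite /box_limit.
have c0 : 0 <= (1 - q)^-1 by rewrite invr_ge0 subr_ge0 ltW.
have V k : (0 < k)%N -> 0 <= (1 - 1 * q ^+ k)^-1 <= (1 - q)^-1.
  move=> k0; have qk : q ^+ k <= q by rewrite -[leRHS]expr1 ler_wiXn2l// ltW.
  have qk1 : 0 < 1 - q ^+ k by rewrite subr_gt0 (le_lt_trans qk).
  have q10 : 0 < 1 - q by rewrite subr_gt0.
  by rewrite mul1r invr_ge0 ltW//= lef_pV2 ?posrE// lerD2l lerN2.
apply: ler_pM.
- by rewrite big_seq prodr_ge0// => j; rewrite mem_index_iota => /andP[/V/andP[]].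
- rewrite big_seq sumr_ge0// => l; rewrite mem_index_iota => /andP[l0 _].
  rewrite big_seq sumr_ge0// => k; rewrite mem_index_iota => /andP[/V/andP[Vk _] _].
  have /V/andP[Vl _] : (0 < 2 * l - 1)%N by lia.
  by rewrite !mulr_ge0// exprn_ge0// ltW.
- by under eq_bigr do rewrite mul1r; exact: prod_1Bexpr_le.
apply: (@le_trans _ _ (\sum_(1 <= l < K.+1) ((1 - q)^-1 * (1 - q)^-1) *
    ((1 - q)^-1 * (q^-1 * q ^+ l)))); last first.
  have qV0 : 0 <= q^-1 by rewrite invr_ge0 ltW.
  by rewrite -!mulr_sumr !ler_wpM2l ?mulr_ge0// sum_expr_le// ltW.
apply: ler_sum_nat => l /andP[l0 _]; rewrite -mulr_suml.
have /V/andP[Vl0 Vl1] : (0 < 2 * l - 1)%N by lia.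
apply: ler_pM.
- rewrite big_seq sumr_ge0// => k; rewrite mem_index_iota => /andP[/V/andP[Vk _] _].
  by rewrite !mulr_ge0// exprn_ge0// ltW.
- by rewrite !mulr_ge0// exprn_ge0// ltW.
- apply: (@le_trans _ _ (\sum_(1 <= k < l) (1 - q)^-1 * q ^+ k)).
    apply: ler_sum_nat => k /andP[/V/andP[_ Vk] _].
    by rewrite mulrC ler_wpM2r// exprn_ge0// ltW.
  by rewrite -mulr_sumr ler_wpM2l// sum_expr_le// ltW.
rewrite mulrC; have -> : q^-1 * q ^+ l = q ^+ (l - 1).
  by rewrite -{1}(prednK l0) exprS mulKf ?gt_eqF// subn1.
by rewrite ler_wpM2r// exprn_ge0// ltW.
Qed.

End Terms.

(** * Convergence of the left-hand side and passage to the limit in K *)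

Section Limits.
Variables (R : realType) (q : R).
Hypothesis q01 : 0 < q < 1.

Let q0 : 0 < q. Proof. by case/andP: q01. Qed.
Let q1 : q < 1. Proof. by case/andP: q01. Qed.
Let q0le1 : 0 <= q < 1. Proof. by rewrite ltW. Qed.

Lemma is_cvg_prod_1Dexpr : cvgn (fun n => \prod_(1 <= j < n) (1 + q ^+ j)^-1).
Proof.
have f0 j : 0 <= (1 + q ^+ j)^-1 by rewrite invr_ge0 addr_ge0// exprn_ge0// ltW.
have f1 j : (1 + q ^+ j)^-1 <= 1.
  have d1 : 1 <= 1 + q ^+ j by rewrite lerDl exprn_ge0// ltW.
  by rewrite invf_le1// (lt_le_trans _ d1).
apply: nonincreasing_is_cvgn; last by exists 0 => _ [n _ <-]; rewrite prodr_ge0.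
apply/nonincreasing_seqP => n; case: n => [|n]; first by rewrite !big_geq.
by rewrite big_nat_recr//= ler_piMr// prodr_ge0.
Qed.

Lemma lhs_inner_bounds l : (0 < l)%N -> 0 <= lhs_inner q l <= q^-1 * q ^+ l.
Proof.
move=> l0; have -> : q^-1 * q ^+ l = q ^+ (l - 1).
  by rewrite -{1}(prednK l0) exprS mulKf ?gt_eqF// subn1.
have d1 : 1 <= 1 + q ^+ (2 * l - 1) by rewrite lerDl exprn_ge0// ltW.
have d0 : 0 < 1 + q ^+ (2 * l - 1) by exact: lt_le_trans d1.
have e0 : 0 <= q ^+ (l - 1) by rewrite exprn_ge0// ltW.
by rewrite /lhs_inner divr_ge0 ?(ltW d0)//= ler_pdivrMr// ler_peMr.
Qed.

Lemma is_cvg_lhs_inner m : (0 < m)%N -> cvgn (fun n => \sum_(m <= l < n) lhs_inner q l).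
Proof.
move=> m0; apply: (is_cvg_sum_geom_dominated (C := q^-1) q0le1) => l ml.
exact: lhs_inner_bounds (leq_trans m0 ml).
Qed.

(** The upper bound is uniform in [k], so [lhs_outer q k] is dominated by a multiple of [q ^+ k]. *)
Lemma lim_lhs_inner_bounds k :
  0 <= limn (fun n => \sum_(k.+1 <= l < n) lhs_inner q l) <= q^-1 * (1 - q)^-1.
Proof.
have ck := @is_cvg_lhs_inner k.+1 isT.
apply/andP; split.
  apply: limr_ge => //; near=> n; rewrite big_seq sumr_ge0// => l.
  rewrite mem_index_iota => /andP[kl _].
  by case/andP: (lhs_inner_bounds (leq_trans (ltn0Sn k) kl)).
apply: limr_le => //; near=> n.
apply: (@le_trans _ _ (\sum_(k.+1 <= l < n) q^-1 * q ^+ l)).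
  apply: ler_sum_nat => l /andP[kl _].
  by case/andP: (lhs_inner_bounds (leq_trans (ltn0Sn k) kl)).
by rewrite -mulr_sumr ler_wpM2l ?sum_expr_le// invr_ge0 ltW.
Unshelve. all: by end_near. Qed.

Lemma lhs_factor_bounds k : 0 <= q ^+ k / (1 + q ^+ k) <= q ^+ k.
Proof.
have e0 : 0 <= q ^+ k by rewrite exprn_ge0// ltW.
have d1 : 1 <= 1 + q ^+ k by rewrite lerDl.
have d0 : 0 < 1 + q ^+ k by exact: lt_le_trans d1.
by rewrite divr_ge0 ?(ltW d0)//= ler_pdivrMr// ler_peMr.
Qed.

Lemma is_cvg_lhs_outer : cvgn (fun n => \sum_(1 <= k < n) lhs_outer q k).
Proof.
apply: (is_cvg_sum_geom_dominated (C := q^-1 * (1 - q)^-1) q0le1) => k k0.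
have /andP[V0 V1] := lim_lhs_inner_bounds k; have /andP[u0 u1] := lhs_factor_bounds k.
by rewrite /lhs_outer mulr_ge0//= mulrC ler_pM.
Qed.

Lemma cvg_box_limit :
  box_limit (-1) q K @[K --> \oo] -->
  limn (fun n => \prod_(1 <= j < n) (1 + q ^+ j)^-1) *
  limn (fun n => \sum_(1 <= k < n) lhs_outer q k).
Proof.
under eq_fun do rewrite /box_limit.
apply: cvgM.
  (* The product is followed along the subsequence of its first 2K factors. *)
  have c2 : (K.*2.+1)%N @[K --> \oo] --> \oo.
    by apply/cvgnyPge => A; near=> K; have : (A <= K)%N; [near: K; exact: nbhs_infty_ge|lia].
  under eq_fun do under eq_bigr do rewrite mulN1r opprK.
  exact: (cvg_comp _ _ c2 is_cvg_prod_1Dexpr).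
have /= := cvg_sum_triangle (u := fun k => q ^+ k / (1 + q ^+ k)) (v := lhs_inner q).
have -> : (fun K => \sum_(1 <= l < K.+1) \sum_(1 <= k < l) q ^+ k / (1 - -1 * q ^+ k) *
      (q ^+ (l - 1) / (1 - -1 * q ^+ (2 * l - 1)))) =
    (fun K => \sum_(1 <= l < K.+1) \sum_(1 <= k < l) q ^+ k / (1 + q ^+ k) * lhs_inner q l).
  by apply/funext => K; apply: eq_bigr => l _; apply: eq_bigr => k _; rewrite !mulN1r !opprK.
apply.
- apply: (is_cvg_sum_geom_dominated (C := 1) q0le1) => k _.
  by rewrite mul1r lhs_factor_bounds.
- exact: is_cvg_lhs_inner.
- exact: is_cvg_lhs_outer.
Unshelve. all: by end_near. Qed.

Lemma cvg_partial_sum_rhs_term :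
  partial_sum (rhs_term q) A @[A --> totally] -->
  limn (fun n => \prod_(1 <= j < n) (1 + q ^+ j)^-1) *
  limn (fun n => \sum_(1 <= k < n) lhs_outer q k).
Proof.
set C := expR ((1 - q)^-1 * (1 - q)^-1) *
    (((1 - q)^-1 * (1 - q)^-1) * ((1 - q)^-1 * (q^-1 * (1 - q)^-1))).
apply: (@cvg_partial_sum _ _ _ _ C) => [A|A e e0]; have [n0 An0] := box_exhaust A.
  (* A box containing [A] bounds its absolute sum; with K = [n0] fixed, the box sums for [s = 1]
     tend to [box_limit 1 q n0]. *)
  apply: le_trans (box_limit_le n0 q01).
  have c1 := @cvg_sum_box R 1 q n0 (normr1 R) q01.
  rewrite -(cvg_lim (@Rhausdorff R) c1); apply: limr_ge; first by apply/cvg_ex; eexists; exact: c1.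
  near=> M; under eq_bigr do rewrite norm_rhs_term ?(ltW q0)//.
  apply: ler_sum_fsubset; first by move=> p; rewrite -norm_rhs_term ?(ltW q0).
  by apply: An0; [lia|near: M; exact: nbhs_infty_ge].
have e20 : 0 < e / 2 by rewrite divr_gt0.
(* First [K], then [M], each at a cost of e/2; both are at least [n0], so the box contains [A]. *)
have [K [nK LK]] : exists K, (n0 <= K)%N /\ `|limn (fun n => \prod_(1 <= j < n) (1 + q ^+ j)^-1) *
  limn (fun n => \sum_(1 <= k < n) lhs_outer q k) - box_limit (-1) q K| < e / 2.
  have /cvgrPdist_lt/(_ _ e20) h := cvg_box_limit.
  by apply: (@filter_ex _ \oo); near=> K; split; near: K; [exact: nbhs_infty_ge|exact: h].
have [M [nM LM]] : exists M, (n0 <= M)%N /\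
  `|box_limit (-1) q K - \sum_(p <- box K.*2 M) signed_term (-1) q p| < e / 2.
  have /cvgrPdist_lt/(_ _ e20) h := @cvg_sum_box R (-1) q K (normrN1 R) q01.
  by apply: (@filter_ex _ \oo); near=> M; split; near: M; [exact: nbhs_infty_ge|exact: h].
exists (box K.*2 M); first by apply: An0 => //; lia.
under eq_bigr do rewrite rhs_termE.
rewrite (splitr e) -[X in X - _](subrK (box_limit (-1) q K)) -addrA.
by apply: le_lt_trans (ler_normD _ _) _; rewrite ltrD.
Unshelve. all: by end_near. Qed.

End Limits.

(* The first five clauses say that the infinite product and the infinite sums in
   the last clause converge; [lim] is only meaningful in that case. *)
Theorem theorem5p4 (R : realType) (q : R) (hq : q = expR (- 1)) :
  cvgn (fun n => \prod_(1 <= j < n) (1 + q ^+ j)^-1) /\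
  (forall k, (1 <= k)%N -> cvgn (fun n => \sum_(k.+1 <= l < n) lhs_inner q l)) /\
  cvgn (fun n => \sum_(1 <= k < n) lhs_outer q k) /\
  (forall p : intpart, cvgn (fun n => \sum_(1 <= l < n) rhs_inner q p l)) /\
  cvg (partial_sum (rhs_term q) @ totally) /\
  \big[*%R/1]_(1 <= j <oo) (1 + q ^+ j)^-1
  * \big[+%R/0]_(1 <= k <oo) lhs_outer q k
  = sum (rhs_term q).

Proof.
have q01 : 0 < q < 1 by rewrite hq expR_gt0 expR_lt1 oppr_lt0 ltr01.
have cp := cvg_partial_sum_rhs_term q01.
split; first exact: is_cvg_prod_1Dexpr.
split; first by move=> k _; exact: is_cvg_lhs_inner.
split; first exact: is_cvg_lhs_outer.
split; first by move=> p; apply/cvg_ex; eexists; exact: cvg_rhs_inner.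
split; first by apply/cvg_ex; eexists; exact: cp.
have ? := @totally_filter intpart.
by symmetry; exact: (cvg_lim (@Rhausdorff R) cp).
Qed.
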